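(* Let $z$ be a Markoff number which is either a prime power or twice a prime power. Then $z$ is unique, i.e.: if $(x,y,z)$ and $(\tilde x,\tilde y,z)$ are Markoff triples with $x\le y\le z$ and $\tilde x\le\tilde y\le z$, then $x=\tilde x$ and $y=\tilde y$.
   Context: A Markoff triple is a triple $(x,y,z)$ of positive integers satisfying $x^2+y^2+z^2=3xyz$. A Markoff number is a positive integer that occurs as an element of some Markoff triple. *)

(* Defs.v *)
From mathcomp Require Import all_boot.

Set Implicit Arguments.
Unset Strict Implicit.
Unset Printing Implicit Defensive.

Definition markoff_triple (x y z : nat) : Prop :=
  [/\ 0 < x, 0 < y, 0 < z & x ^ 2 + y ^ 2 + z ^ 2 = 3 * x * y * z].

Definition markoff_number (m : nat) : Prop :=
  exists x y z : nat, markoff_triple x y z /\ m \in [:: x; y; z].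

(* The exponent is positive, so 1 is not a prime power. *)
Definition prime_power (q : nat) : Prop :=
  exists p k : nat, [/\ prime p, 0 < k & q = p ^ k].

(* Main.v *)
(* Hang the Markoff triples on a binary tree whose nodes are triples
   (m1, u1), (m, u), (m2, u2), where m is the largest element and the numbers
   u satisfy m1 u - m u1 = m2, m u2 - m2 u = m1 and u^2 = -1 mod m.  The first
   two identities say u1/m1 < u/m < u2/m2, so u/m is strictly monotone for the
   in-order traversal of the tree, and a node is determined by (m, u).  Since
   all u/m lie strictly between 0/1 and 1/2, and -1 has a single square root
   below m/2 modulo a prime power or twice a prime power, m determines u. *)
Require Import Defs.
From mathcomp Require Import all_boot.
From mathcomp Require Import all_order all_algebra zify ring.

Set Implicit Arguments.
Unset Strict Implicit.
Unset Printing Implicit Defensive.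

Import Order.TTheory GRing.Theory Num.Theory.

(** * The binary tree of triples and its fractions u/m *)

Record node := Node {
  lm : int; lu : int; mm : int; mu : int; rm : int; ru : int }.

Section Tree.

Local Open Scope ring_scope.

(** A Vieta jump: [true] drops the left pair and [false] the right one. The new [u] obeys the
    recursion of the new [m], with the same coefficient. *)
Definition step (n : node) (b : bool) : node :=
  let: Node m1 u1 m u m2 u2 := n in
  if b then Node m u (3 * m * m2 - m1) (3 * m2 * u - u1) m2 u2
  else Node m1 u1 (3 * m1 * m - m2) (3 * m1 * u - u2) m u.

(** The triple (1, 5, 2) with fractions 0/1 < 2/5 < 1/2. The triples (1, 1, 1) and (1, 1, 2) stay
    outside the tree. *)
Definition root_node : node := Node 1 0 5 2 2 1.

(* [v = (u^2 + 1) / m] obeys the same linear recursion as [m] and [u], so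
   its integrality is carried by the quadratic form [m v - u^2] together with
   the values of its polarization on the three pairs. *)
Definition node_inv (n : node) : Prop :=
  let: Node m1 u1 m u m2 u2 := n in
  [/\ [/\ 0 < m1, 0 < m2, m1 <= m & m2 <= m],
      [/\ m1 * u - m * u1 = m2, m * u2 - m2 * u = m1 &
          m1 * u2 - m2 * u1 = 3 * m1 * m2 - m] &
      exists v1 v v2 : int,
        [/\ m1 * v1 = u1 ^+ 2 + 1, m * v = u ^+ 2 + 1 & m2 * v2 = u2 ^+ 2 + 1]
        /\ [/\ m * v2 + m2 * v - 2 * u * u2 = 3 * m1,
              m1 * v + m * v1 - 2 * u1 * u = 3 * m2 &
              m1 * v2 + m2 * v1 - 2 * u1 * u2 = 3 * (3 * m1 * m2 - m)]].

Lemma root_node_inv : node_inv root_node.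
Proof. by split=> //; exists 1, 1, 1. Qed.

(** Certificate checking: the coefficients are supplied by hand and [ring] verifies the remaining
    identity. Spare slots get coefficient 0. *)
Lemma eq_lincomb (a b c1 l1 r1 c2 l2 r2 c3 l3 r3 : int) :
  l1 = r1 -> l2 = r2 -> l3 = r3 ->
  a - b = c1 * (l1 - r1) + c2 * (l2 - r2) + c3 * (l3 - r3) -> a = b.
Proof.
move=> -> -> ->; rewrite !subrr !mulr0 !addr0 => /eqP.
by rewrite subr_eq0 => /eqP.
Qed.

Lemma mul3_sub_ge (a b c : int) :
  0 < a -> c <= b -> 0 < b -> b <= 3 * a * b - c /\ a <= 3 * a * b - c.
Proof. by move=> *; split; nia. Qed.

Lemma step_inv n b : node_inv n -> node_inv (step n b).
Proof.
case: n => m1 u1 m u m2 u2 [] [p1 p2 l1 l2] [d1 d2 d3].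
move=> [v1 [v [v2 [[q1 q q2] [b2 b1 b12]]]]].
have p : 0 < m := lt_le_trans p1 l1.
case: b => /=; split.
- have [? ?] := mul3_sub_ge p2 l1 p.
  by rewrite -!mulrA [m * m2]mulrC !mulrA.
- split.
  + by apply: (eq_lincomb (c1 := 1) (c2 := 0) (c3 := 0) d1 d1 d1); ring.
  + by apply: (eq_lincomb (c1 := 3 * m2) (c2 := -1) (c3 := 0) d2 d3 d3); ring.
  + by apply: (eq_lincomb (c1 := 1) (c2 := 0) (c3 := 0) d2 d2 d2); ring.
(* The new vector is 3 m2 (m, u, v) - (m1, u1, v1); the coefficients below come from expanding the
   quadratic form and its polarization on it. *)
- exists v, (3 * m2 * v - v1), v2; split; split=> //.
  + by apply: (eq_lincomb (c1 := 9 * m2 ^+ 2) (c2 := - 3 * m2) (c3 := 1) q b1 q1); ring.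
  + by apply: (eq_lincomb (c1 := 3 * m2) (c2 := -1) (c3 := 0) b2 b12 b12); ring.
  + by apply: (eq_lincomb (c1 := 6 * m2) (c2 := -1) (c3 := 0) q b1 q); ring.
  + by apply: (eq_lincomb (c1 := 1) (c2 := 0) (c3 := 0) b2 b2 b2); ring.
- by have [? ?] := mul3_sub_ge p1 l2 p.
- split.
  + by apply: (eq_lincomb (c1 := 3 * m1) (c2 := -1) (c3 := 0) d1 d3 d3); ring.
  + by apply: (eq_lincomb (c1 := 1) (c2 := 0) (c3 := 0) d2 d2 d2); ring.
  + by apply: (eq_lincomb (c1 := 1) (c2 := 0) (c3 := 0) d1 d1 d1); ring.
- exists v1, (3 * m1 * v - v2), v; split; split=> //.
  + by apply: (eq_lincomb (c1 := 9 * m1 ^+ 2) (c2 := - 3 * m1) (c3 := 1) q b2 q2); ring.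
  + by apply: (eq_lincomb (c1 := 6 * m1) (c2 := -1) (c3 := 0) q b2 q); ring.
  + by apply: (eq_lincomb (c1 := 3 * m1) (c2 := -1) (c3 := 0) b1 b12 b12); ring.
  + by apply: (eq_lincomb (c1 := 1) (c2 := 0) (c3 := 0) b1 b1 b1); ring.
Qed.

Lemma descend_inv n s : node_inv n -> node_inv (foldl step n s).
Proof. by elim: s n => //= b s IHs n /(step_inv b)/IHs. Qed.

Lemma frac_lt_trans (a b c d e f : int) : 0 < b -> 0 < d -> 0 < f ->
  a * d < c * b -> c * f < e * d -> a * f < e * b.
Proof.
move=> b0 d0 f0 h1 h2; rewrite -(ltr_pM2r d0).
rewrite [ltLHS](_ : _ = a * d * f); last ring.
rewrite [ltRHS](_ : _ = e * d * b); last ring.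
apply: (@lt_trans _ _ (c * b * f)); first by rewrite ltr_pM2r.
by rewrite mulrAC ltr_pM2r.
Qed.

(** Each step cuts the interval between the outer fractions at u/m and keeps one half, so intervals
    along a path are nested. *)
Lemma descend_between n s : node_inv n ->
  let k := foldl step n s in
  lu n * mm k < mu k * lm n /\ mu k * rm n < ru n * mm k.
Proof.
elim: s n => [|b s IHs] [m1 u1 m u m2 u2] inv_n.
  case: inv_n => [[? ? ? ?] [? ? ?] _]; split=> /=; lia.
have /= := IHs _ (step_inv b inv_n).
have := descend_inv s (step_inv b inv_n).
case: (foldl _ _ _) => m1' u1' m' u' m2' u2' [[? ? ? ?] _ _].
case: inv_n => [[? ? ? ?] [? ? ?] _].
case: b => /= -[h1 h2]; split=> //.
- by apply: (frac_lt_trans (c := u) (d := m)); lia.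
- by apply: (frac_lt_trans (c := u) (d := m)); lia.
Qed.

(** Where two paths part, the fraction of the last common node separates their ends strictly. *)
Lemma descend_inj n s t : node_inv n ->
  mm (foldl step n s) = mm (foldl step n t) ->
  mu (foldl step n s) = mu (foldl step n t) -> s = t.
Proof.
have left_lt k r : node_inv k ->
    mu (foldl step (step k false) r) * mm k
      < mu k * mm (foldl step (step k false) r).
  by case: k => m1 u1 m u m2 u2 /(step_inv false)/descend_between-/(_ r)[].
have right_gt k r : node_inv k ->
    mu k * mm (foldl step (step k true) r)
      < mu (foldl step (step k true) r) * mm k.
  by case: k => m1 u1 m u m2 u2 /(step_inv true)/descend_between-/(_ r)[].
elim: s n t => [|b s IHs] n [|c t] inv_n //=.
- move=> em eu; exfalso; case: c em eu => em eu.
    by have := right_gt n t inv_n; rewrite -em -eu ltxx.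
  by have := left_lt n t inv_n; rewrite -em -eu ltxx.
- move=> em eu; exfalso; case: b em eu => em eu.
    by have := right_gt n s inv_n; rewrite em eu ltxx.
  by have := left_lt n s inv_n; rewrite em eu ltxx.
case: (eqVneq b c) => [->|neq_bc] em eu.
  by rewrite (IHs _ t (step_inv c inv_n)).
exfalso; case: b c neq_bc em eu => -[] // _ em eu.
  by have := right_gt n s inv_n; rewrite em eu ltNge ltW ?left_lt.
by have := right_gt n t inv_n; rewrite -em -eu ltNge ltW ?left_lt.
Qed.

Lemma root_descend_bounds s (n := foldl step root_node s) :
  [/\ 0 < mm n, 0 < mu n, 2 * mu n < mm n & exists v, mm n * v = mu n ^+ 2 + 1].
Proof.
have [] := descend_between s root_node_inv; rewrite -/n.
have := descend_inv s root_node_inv; rewrite -/n.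
case: n => m1 u1 m u m2 u2 [[p1 _ l1 _] _ [_ [v [_ [[_ ? _] _]]]]] /= lo hi.
split; [lia | lia | lia | by exists v].
Qed.

End Tree.

(** * Markoff descent and completeness of the tree *)

Lemma markoff_tripleC x y z : markoff_triple x y z -> markoff_triple y x z.
Proof. by case=> *; split=> //; lia. Qed.

(** The other root w of the quadratic in [z] satisfies w + z = 3xy and wz = x^2 + y^2. The last
    bound makes the truncated subtraction exact. *)
Lemma markoff_descent x y z : markoff_triple x y z -> x <= y <= z -> 2 < z ->
  [/\ markoff_triple x (3 * x * y - z) y, 3 * x * y - z < y, y < z
    & z <= 3 * x * y].
Proof.
case=> x0 y0 z0 e /andP[xy yz] z2.
have zle : z <= 3 * x * y by nia.
have [w ew] : exists w, 3 * x * y = z + w by exists (3 * x * y - z); rewrite subnKC.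
have wz : w * z = x ^ 2 + y ^ 2 by nia.
have w0 : 0 < w by nia.
rewrite ew addKn.
have ltyz : y < z by nia.
split=> //; [|nia|lia].
by split=> //; nia.
Qed.

(** Strong induction on the maximum: descent gives the parent node. Left and right do not follow
    size, hence the two alternatives. *)
Lemma markoff_triple_in_tree x y z :
  markoff_triple x y z -> x <= z -> y <= z -> 2 < z ->
  exists s, let n := foldl step root_node s in
    [/\ mm n = z, lm n = x & rm n = y] \/
    [/\ mm n = z, lm n = y & rm n = x].
Proof.
elim/ltn_ind: z x y => z IHz x y; wlog le_xy : x y / x <= y.
  move=> wlog_le h xz yz z2; case/orP: (leq_total x y) => le.
    exact: wlog_le.
  have [s [n_s|n_s]] := wlog_le _ _ le (markoff_tripleC h) yz xz z2; exists s.
    by right.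
  by left.
move=> h xz yz z2.
have [h' ltwy ltyz zle] := markoff_descent h (introT andP (conj le_xy yz)) z2.
case: (leqP y 2) => y2.
  exists [::]; left.
  case: h => x0 y0 z0 e.
  have [[? ?]|[[? ?]|[? ?]]] : x = 1 /\ y = 1 \/ x = 1 /\ y = 2 \/ x = 2 /\ y = 2 by lia.
  - by subst; exfalso; nia.
  - subst; have -> : z = 5 by nia.
    by [].
  - by subst; exfalso; nia.
have [s] := IHz y ltyz _ _ h' le_xy (ltnW ltwy) y2.
case E: (foldl step root_node s) => [m1 u1 m u m2 u2] /=.
case=> -[? ? ?]; subst.
(* The last step drops the side holding w = 3xy - z, and 3xy - w gives back [z]. *)
- exists (rcons s false); left; rewrite foldl_rcons E /=; split=> //; lia.
- exists (rcons s true); right; rewrite foldl_rcons E /=; split=> //; lia.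
Qed.

(** * Square roots of -1 modulo a prime power or twice one *)

Lemma not_dvdn4_sqr_add1 u : ~~ (4 %| u ^ 2 + 1).
Proof.
rewrite /dvdn -modnDml -modnXm.
by have := ltn_pmod u (isT : 0 < 4); case: (u %% 4) => [|[|[|[|]]]].
Qed.

Lemma half_sqrt_neg1_unique q u v :
  prime_power q \/ (exists r, prime_power r /\ q = 2 * r) -> 2 < q ->
  q %| u ^ 2 + 1 -> q %| v ^ 2 + 1 -> 2 * u < q -> 2 * v < q -> u = v.
Proof.
move=> hq q2; wlog le_uv : u v / u <= v.
  move=> wlog_le du dv u2 v2; case/orP: (leq_total u v) => le; first exact: wlog_le.
  by symmetry; apply: wlog_le.
move=> du dv u2 v2.
have {hq} [p [k [e [p_pr k0 e12 eq_q]]]] :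
    exists p k e, [/\ prime p, 0 < k, e = 1 \/ e = 2 & q = e * p ^ k].
  case: hq => [[p [k [? ? ->]]] | [r [[p [k [? ? ->]]] ->]]].
    by exists p, k, 1; split=> //; [left | rewrite mul1n].
  by exists p, k, 2; split=> //; right.
have dp : p ^ k %| q by rewrite eq_q dvdn_mull.
have p_q : p %| q by apply: dvdn_trans dp; rewrite dvdn_exp.
(* If p = 2, then q > 2 forces 4 to divide q, hence u^2 + 1. *)
have odd_p : odd p.
  case: (even_prime p_pr) => // p2; exfalso.
  have : 4 %| q.
    rewrite eq_q p2; rewrite eq_q p2 in q2; case: e12 q2 => ->.
      by rewrite mul1n; case: k {k0 eq_q dp} => [|[|k]] // _; apply: (@dvdn_exp2l 2 2).
    by case: k k0 {eq_q dp} => // k _ _; rewrite -expnS; apply: (@dvdn_exp2l 2 2).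
  by move/dvdn_trans/(_ du); apply/negP/not_dvdn4_sqr_add1.
have dprod : q %| (v - u) * (v + u).
  have -> : (v - u) * (v + u) = (v ^ 2 + 1) - (u ^ 2 + 1) by rewrite subnDr subn_sqr.
  exact: dvdn_sub.
(* A common factor p would divide 2v, hence v, hence 1; so all of p^k lies in one factor. *)
have not_both : ~~ ((p %| v - u) && (p %| v + u)).
  apply/negP => /andP[d1 d2].
  have d2v : p %| 2 * v.
    have -> : 2 * v = (v - u) + (v + u) by rewrite addnCA subnK // addnn mul2n.
    exact: dvdn_add.
  have dpv : p %| v.
    by rewrite -(@Gauss_dvdr p 2) // coprime_sym prime_coprime // dvdn2 odd_p.
  have := dvdn_trans p_q dv; rewrite dvdn_addr ?dvdn1; last by rewrite dvdn_mulr.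
  by move/eqP => p1; rewrite p1 in p_pr.
(* For q = 2p^k, both u and v are odd, so either factor also absorbs the 2. *)
have dvd_factor w : p ^ k %| w -> w = v - u \/ w = v + u -> q %| w.
  move=> dw w_uv; rewrite eq_q; case: e12 => e_eq; first by rewrite e_eq mul1n.
  rewrite e_eq Gauss_dvd ?dw ?andbT; last by rewrite coprimeXr // coprime2n.
  have two_q : 2 %| q by rewrite eq_q e_eq dvdn_mulr.
  have := dvdn_trans two_q du; have := dvdn_trans two_q dv.
  rewrite !dvdn2 !oddD !oddX /= => odd_v odd_u.
  by case: w_uv => ->; rewrite ?oddB // ?oddD; case: (odd u) (odd v) odd_u odd_v => -[].
have : (q %| v - u) || (q %| v + u).
  case: (boolP (p %| v - u)) not_both => /= pd not_sum.
  - apply/orP; left; apply: dvd_factor; last by left.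
    rewrite -(@Gauss_dvdl _ _ (v + u)) ?(dvdn_trans dp) //.
    by rewrite coprimeXl // prime_coprime.
  - apply/orP; right; apply: dvd_factor; last by right.
    rewrite -(@Gauss_dvdr _ (v - u)) ?(dvdn_trans dp) //.
    by rewrite coprimeXl // prime_coprime.
(* Both factors are below q, so the one divisible by q is 0. *)
case/orP => /dvdn_leq le_q.
  clear -le_q le_uv u2 v2; case: (posnP (v - u)) le_q => [|_ /(_ isT)]; lia.
clear -le_q le_uv u2 v2; case: (posnP (v + u)) le_q => [|_ /(_ isT)]; lia.
Qed.

(** * Uniqueness, with the triples outside the tree treated apart *)

Lemma markoff_triple_max2 x y z : markoff_triple x y z -> x <= z -> y <= z ->
  z <= 2 -> x = 1 /\ y = 1.
Proof.
case=> x0 y0 z0 e xz yz z2.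
have : x <= 2 by lia.
have : y <= 2 by lia.
by move: x y z x0 y0 z0 e xz yz z2 => [|[|[|x]]] [|[|[|y]]] [|[|[|z]]].
Qed.

Lemma root_descend_nat s (z : nat) (n := foldl step root_node s) : mm n = z ->
  exists u : nat, [/\ mu n = u, 2 * u < z & z %| u ^ 2 + 1].
Proof.
have [p0 u0 hu [v ev]] := root_descend_bounds s.
rewrite -/n in p0 u0 hu ev * => em.
exists `|mu n|%N; split; [lia | lia |].
apply/dvdnP; exists `|v|%N; nia.
Qed.

Theorem theorem1 (z : nat) (hz : markoff_number z)
    (hpp : prime_power z \/ exists q : nat, prime_power q /\ z = 2 * q)
    (x y x' y' : nat)
    (h : markoff_triple x y z) (hxy : x <= y) (hyz : y <= z)
    (h' : markoff_triple x' y' z) (hxy' : x' <= y') (hyz' : y' <= z) :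
  x = x' /\ y = y'.
Proof.
have hxz := leq_trans hxy hyz; have hxz' := leq_trans hxy' hyz'.
case: (leqP z 2) => z2.
  have [-> ->] := markoff_triple_max2 h hxz hyz z2.
  by have [-> ->] := markoff_triple_max2 h' hxz' hyz' z2.
have [s hs] := markoff_triple_in_tree h hxz hyz z2.
have [t ht] := markoff_triple_in_tree h' hxz' hyz' z2.
have ms : mm (foldl step root_node s) = z by case: hs => -[].
have mt : mm (foldl step root_node t) = z by case: ht => -[].
have [u [eu u2 du]] := root_descend_nat ms.
have [v [ev v2 dv]] := root_descend_nat mt.
have uv := half_sqrt_neg1_unique hpp z2 du dv u2 v2.
have st : s = t by apply: (descend_inj root_node_inv); rewrite ?ms ?mt ?eu ?ev ?uv.
rewrite st in hs.
(* The common node fixes the pair up to order; x <= y and x' <= y' settle the order. *)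
by case: hs => -[_ e1 e2]; case: ht => -[_ e3 e4]; rewrite e1 in e3; rewrite e2 in e4; lia.
Qed.
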